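(* Let $LB$ be a lower bound on the optimal objective function value of the discrete $\alpha$-neighbor $p$-center problem. Then $\mathcal{L}'_\alpha(LB)=LB$ holds if and only if there is a feasible solution for $(\mathrm{AFSC})_{LB}$ with objective function value at most $p$.
   Context: Discrete $\alpha$-neighbor $p$-center problem (d-$\alpha$-$p$CP): given are a finite set of points $N$, a positive integer $p<|N|$, a positive integer $\alpha\le p$, and distances $d_{ij}\ge 0$ for $i,j\in N$. A feasible solution is a set $P\subseteq N$ with $|P|=p$ (open facilities). For $i\in N\setminus P$ let $d_\alpha(P,i)=\min_{A\subseteq P,|A|=\alpha}\max_{j\in A} d_{ij}$, and let $f_\alpha(P)=\max_{i\in N\setminus P} d_\alpha(P,i)$ be the objective function value of $P$. The problem is $\min_{P\subseteq N,|P|=p} f_\alpha(P)$. $\mathcal{L}'_\alpha(LB)$ denotes the optimal objective function value of the linear program (APCLB') in real variables $y_j$ ($j\in N$), $x_{ij}$ ($i,j\in N$, $i\ne j$), $z$: minimize $z$ subject to - $\sum_{j\in N} y_j=p$; - $\sum_{j\in N\setminus\{i\}} x_{ij}=\alpha(1-y_i)$ for all $i\in N$; - $x_{ij}\le y_j$ for all $i,j\in N$, $i\ne j$; - $\max\{LB,d_{ij}\}x_{ij}\le z$ for all $i,j\in N$, $i\ne j$; - $\alpha\,LB\,y_i+\sum_{j\in N\setminus\{i\}}\max\{LB,d_{ij}\}x_{ij}\le\alpha z$ for all $i\in N$; - $0\le x_{ij}$ for all $i,j\in N$, $i\ne j$; $0\le y_j\le 1$ for all $j\in N$; $z\ge LB$.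 For $\delta\in\mathbb{R}$, $(\mathrm{AFSC})_\delta$ is the linear program: minimize $\sum_{j\in N}y_j$ subject to $\sum_{j\in N\setminus\{i\}:\, d_{ij}\le\delta} y_j\ge\alpha(1-y_i)$ for all $i\in N$ and $0\le y_j\le1$ for all $j\in N$. *)

(* Defs.v *)
From HB Require Import structures.
From mathcomp Require Import all_boot all_order all_algebra.
From mathcomp Require Import all_classical all_reals all_analysis.

Set Implicit Arguments.
Unset Strict Implicit.
Unset Printing Implicit Defensive.

Import Order.TTheory GRing.Theory Num.Theory.

Local Open Scope classical_set_scope.
Local Open Scope ring_scope.

(* Minima and maxima are taken in the extended reals: +oo is the minimum over
   an empty family (infeasible problem) and -oo the maximum over an empty
   family, so no real default value interferes. *)

Definition d_alpha (R : realType) (N : finType) (d : N -> N -> R) (alpha : nat)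
    (P : {set N}) (i : N) : \bar R :=
  \big[mine/+oo%E]_(A : {set N} | (A \subset P) && (#|A| == alpha))
    \big[maxe/-oo%E]_(j in A) (d i j)%:E.

Definition f_alpha (R : realType) (N : finType) (d : N -> N -> R) (alpha : nat)
    (P : {set N}) : \bar R :=
  \big[maxe/-oo%E]_(i in ~: P) d_alpha d alpha P i.

Definition pCP_opt (R : realType) (N : finType) (d : N -> N -> R)
    (alpha p : nat) : \bar R :=
  \big[mine/+oo%E]_(P : {set N} | #|P| == p) f_alpha d alpha P.

(* The variables x_ij exist only for i != j: the diagonal values of x below
   are irrelevant, as no constraint mentions them. *)
Definition APCLB'_feasible (R : realType) (N : finType) (d : N -> N -> R)
    (alpha p : nat) (LB : R) (y : N -> R) (x : N -> N -> R) (z : R) : Prop :=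
  (\sum_j y j = p%:R) /\
  (forall i, \sum_(j | j != i) x i j = alpha%:R * (1 - y i)) /\
  (forall i j, i != j -> x i j <= y j) /\
  (forall i j, i != j -> Num.max LB (d i j) * x i j <= z) /\
  (forall i, alpha%:R * LB * y i
             + \sum_(j | j != i) Num.max LB (d i j) * x i j <= alpha%:R * z) /\
  (forall i j, i != j -> 0 <= x i j) /\
  (forall j, 0 <= y j <= 1) /\
  LB <= z.

Definition APCLB'_opt (R : realType) (N : finType) (d : N -> N -> R)
    (alpha p : nat) (LB : R) : \bar R :=
  ereal_inf [set z%:E | z in
    [set z : R | exists y x, APCLB'_feasible d alpha p LB y x z]].

Definition AFSC_feasible (R : realType) (N : finType) (d : N -> N -> R)
    (alpha : nat) (delta : R) (y : N -> R) : Prop :=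
  (forall i, \sum_(j | (j != i) && (d i j <= delta)) y j
             >= alpha%:R * (1 - y i)) /\
  (forall j, 0 <= y j <= 1).

(* Main.v *)
Require Import Defs.
From HB Require Import structures.
From mathcomp Require Import all_boot all_order all_algebra.
From mathcomp Require Import all_classical all_reals all_analysis.
From mathcomp Require Import lra.

(** Write [S_i = {j != i : d i j <= LB}].

    If [y] is feasible for (AFSC) at [LB] with total at most [p], moving [y]
    towards the all-one vector keeps it feasible, so the total may be taken to
    be exactly [p] ([AFSC_feasible_sum_eq]).  Each [i] then distributes its
    demand [alpha * (1 - y i)] over [S_i] proportionally to [y]
    ([exists_proportional_share]), and the result is feasible for (APCLB') with
    [z = LB], the smallest value that the program allows
    ([AFSC_feasible_APCLB']).

    Conversely, subtracting [LB] times the demand equation of [i] from its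
    aggregated cost constraint bounds the assignment to facilities farther than
    [LB] by a multiple of [z - LB] ([APCLB'_deficit]).  Hence solutions whose
    value tends to [LB] violate (AFSC) by arbitrarily little.  The optimal value
    is only an infimum, so a genuine solution is produced by compactness of the
    cube [0, 1]^N: the total violation attains its minimum there, and that
    minimum is 0 ([compact_approx_feasible]). *)

Set Implicit Arguments.
Unset Strict Implicit.
Unset Printing Implicit Defensive.

Import Order.TTheory GRing.Theory Num.Theory.
Import numFieldNormedType.Exports.

Local Open Scope classical_set_scope.
Local Open Scope ring_scope.

Lemma continuous_finite_sum (R : realType) (T : topologicalType) (I : finType)
    (P : pred I) (f : I -> T -> R) :
  (forall k, continuous (f k)) -> continuous (fun t => \sum_(k | P k) f k t).
Proof.
move=> cf t; apply: (@cvg_big R I +%R 0 P); first exact: add_continuous.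
by move=> k _; exact: cf.
Qed.

(** The sum of the positive parts of the constraint functions attains its
    minimum on [K]; being smaller than every positive number, it is 0. *)
Lemma compact_approx_feasible (R : realType) (T : topologicalType)
    (I : finType) (K : set T) (g : I -> T -> R) :
  compact K -> (forall k, continuous (g k)) ->
  (forall e, 0 < e -> exists2 t, K t & forall k, g k t <= e) ->
  exists2 t, K t & forall k, g k t <= 0.
Proof.
move=> cK cg approx.
pose f t := \sum_k Num.max 0 (g k t).
have cf : continuous f.
  apply: (continuous_finite_sum (P := xpredT)) => k t.
  by apply: (@continuous_max _ _ (cst 0) (g k) t); [exact: cvg_cst|exact: cg].
have [t0 Kt0 _] := approx 1 ltr01.
have [c /set_mem Kc fc_min] : exists2 c, c \in K & forall t, t \in K -> f c <= f t.
  apply: compact_EVT_min => //; first by exists t0.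
  exact: continuous_subspaceT.
have le_f k : Num.max 0 (g k c) <= f c.
  rewrite /f (bigD1 k) //= lerDl; apply: sumr_ge0 => j _.
  by rewrite le_max lexx.
suff fc_le0 : f c <= 0.
  exists c => // k; apply: le_trans fc_le0; apply: le_trans (le_f k).
  by rewrite le_max lexx orbT.
rewrite leNgt; apply/negP => fc_gt0.
have n_gt0 : 0 < (#|I|.+1%:R : R) by rewrite ltr0n.
(* With [#|I|] violations of this size, the total stays below [f c]. *)
have [t Kt gt] := approx (f c / #|I|.+1%:R) (divr_gt0 fc_gt0 n_gt0).
have : f t <= \sum_(k : I) f c / #|I|.+1%:R.
  by apply: ler_sum => k _; rewrite ge_max gt andbT divr_ge0 // ltW.
rewrite sumr_const -[X in _ <= X]mulr_natr => ft.
have : f c <= f c / #|I|.+1%:R * #|I|%:R.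
  by apply: le_trans (fc_min t _) ft; exact/mem_set.
by rewrite -mulrA ler_pMr // mulrC ler_pdivlMr // mul1r ler_nat ltnn.
Qed.

Lemma finite_gap (R : realType) (I : finType) (v : I -> R) (b : R) :
  exists2 m, 0 < m & forall k, b < v k -> m <= v k - b.
Proof.
exists (\big[Num.min/1]_(k | b < v k) (v k - b)).
  by elim/big_ind: _ => // [x y|k]; rewrite ?lt_min ?subr_gt0 // => -> ->.
by move=> k bk; apply: bigmin_le_cond.
Qed.

(** Raising [y] can only help the covering constraints, so [y] is replaced by
    the point of total [b] on the segment from [y] to the all-one vector. *)
Lemma AFSC_feasible_sum_eq (R : realType) (N : finType) (d : N -> N -> R)
    (alpha : nat) (delta b : R) (y : N -> R) :
  AFSC_feasible d alpha delta y -> \sum_j y j <= b -> b < #|N|%:R ->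
  exists2 y' : N -> R, AFSC_feasible d alpha delta y' & \sum_j y' j = b.
Proof.
move=> [cover y01] sum_le b_lt; set S := \sum_j y j in sum_le.
have D_gt0 : 0 < #|N|%:R - S by lra.
set s := (b - S) / (#|N|%:R - S).
have s_ge0 : 0 <= s by rewrite divr_ge0 //; lra.
have s_le1 : s <= 1 by rewrite ler_pdivrMr // mul1r; lra.
have le_y' j : y j <= y j + s * (1 - y j).
  by rewrite lerDl mulr_ge0 //; have /andP[_ ?] := y01 j; lra.
exists (fun j => y j + s * (1 - y j)).
  split=> [i|j]; last first.
    by have /andP[? ?] := y01 j; apply/andP; split; nra.
  apply: le_trans (ler_sum _ (fun j _ => le_y' j)).
  apply: le_trans (cover i); apply: ler_wpM2l; first exact: ler0n.
  by have := le_y' i; lra.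
rewrite big_split /= -mulr_sumr sumrB sumr_const -/S.
by rewrite /s divfK ?gt_eqF // addrC subrK.
Qed.

Lemma exists_proportional_share (R : realType) (N : finType) (A : pred N)
    (y : N -> R) (c : R) :
  (forall j, 0 <= y j) -> 0 <= c -> c <= \sum_(j | A j) y j ->
  exists x : N -> R, [/\ forall j, 0 <= x j <= y j,
    forall j, ~~ A j -> x j = 0 & \sum_(j | A j) x j = c].
Proof.
move=> y_ge0 c_ge0 c_le; set S := \sum_(j | A j) y j in c_le *.
have S_ge0 : 0 <= S by exact: sumr_ge0.
(* When [S = 0] also [c = 0], and [c / 0 = 0] is the right ratio. *)
have r_ge0 : 0 <= c / S by rewrite divr_ge0.
have rS : c / S * S = c.
  have [S0|S0] := eqVneq S 0; last by rewrite divfK.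
  by rewrite S0 mulr0; apply/eqP; rewrite eq_le c_ge0 -S0 c_le.
have r_le1 : c / S <= 1.
  have [S0|S0] := eqVneq S 0; first by rewrite S0 invr0 mulr0 ler01.
  by rewrite ler_pdivrMr ?mul1r // lt_neqAle eq_sym S0.
exists (fun j => if A j then c / S * y j else 0); split=> [j|j /negbTE -> //|].
  case: ifP => _; last by rewrite lexx y_ge0.
  by rewrite mulr_ge0 //= ler_piMl.
rewrite -[RHS]rS mulr_sumr; apply: eq_bigr => j Aj.
by rewrite Aj.
Qed.

(** For negative [delta] no facility is within reach, which forces [y = 1]. *)
Lemma AFSC_feasible_delta_ge0 (R : realType) (N : finType) (d : N -> N -> R)
    (alpha : nat) (delta : R) (y : N -> R) :
  (forall i j, 0 <= d i j) -> (0 < alpha)%N -> AFSC_feasible d alpha delta y ->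
  \sum_j y j < #|N|%:R -> 0 <= delta.
Proof.
move=> d_ge0 alpha_gt0 [cover y01] sum_lt; rewrite leNgt; apply/negP => delta_lt0.
suff : #|N|%:R <= \sum_j y j by rewrite leNgt sum_lt.
rewrite -sumr_const; apply: ler_sum => i _.
have := cover i; rewrite big1 => [|j /andP[_ dj]].
  by rewrite pmulr_rle0 ?ltr0n // subr_le0.
by have := d_ge0 i j; lra.
Qed.

(** Assigning only within distance [LB] makes every cost equal to [LB], so all
    constraints on [z] hold with [z = LB]. *)
Lemma AFSC_feasible_APCLB' (R : realType) (N : finType) (d : N -> N -> R)
    (alpha p : nat) (LB : R) (y : N -> R) :
  0 <= LB -> AFSC_feasible d alpha LB y -> \sum_j y j = p%:R ->
  exists x, APCLB'_feasible d alpha p LB y x LB.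
Proof.
move=> LB_ge0 [cover y01] sum_y.
have y_ge0 j : 0 <= y j by have /andP[] := y01 j.
have /choice[x xP] : forall i, exists x : N -> R,
    [/\ forall j, 0 <= x j <= y j,
      forall j, ~~ ((j != i) && (d i j <= LB)) -> x j = 0 &
      \sum_(j | (j != i) && (d i j <= LB)) x j = alpha%:R * (1 - y i)].
  move=> i; apply: exists_proportional_share => //.
  by rewrite mulr_ge0 ?ler0n // subr_ge0; have /andP[] := y01 i.
have x_ge0 i j : 0 <= x i j by have [/(_ j)/andP[]] := xP i.
have x_le i j : x i j <= y j by have [/(_ j)/andP[]] := xP i.
have sum_x i : \sum_(j | j != i) x i j = alpha%:R * (1 - y i).
  have [_ x0 <-] := xP i; rewrite [LHS](bigID (fun j => d i j <= LB)) /=.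
  rewrite [X in _ + X]big1 ?addr0 // => j /andP[_ /negbTE dj].
  by apply: x0; rewrite dj andbF.
have costE i j : j != i -> Num.max LB (d i j) * x i j = LB * x i j.
  move=> ji; have [dj|dj] := leP (d i j) LB; first by [].
  have [_ -> //] := xP i; first by rewrite !mulr0.
  by rewrite ji leNgt dj.
exists x; split=> //; split=> //; split=> [i j _ //|].
split=> [i j ij|].
  rewrite costE 1?eq_sym // ler_piMr //.
  by apply: le_trans (x_le i j) _; have /andP[] := y01 j.
split=> [i|//].
by rewrite (eq_bigr _ (costE i)) -mulr_sumr sum_x; lra.
Qed.

(** The excess costs [Num.max LB (d i j) - LB] of client [i] add up to at most
    [alpha * (z - LB)], and each facility beyond [LB] costs at least [m] extra
    per unit. *)
Lemma APCLB'_deficit (R : realType) (N : finType) (d : N -> N -> R)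
    (alpha p : nat) (LB m z : R) (y : N -> R) (x : N -> N -> R) :
  0 < m -> (forall i j, LB < d i j -> m <= d i j - LB) ->
  APCLB'_feasible d alpha p LB y x z ->
  forall i, alpha%:R * (1 - y i) - \sum_(j | (j != i) && (d i j <= LB)) y j
            <= alpha%:R * (z - LB) / m.
Proof.
move=> m_gt0 gap [_ [sum_x [x_le [_ [cost [x_ge0 _]]]]]] i.
pose far := \sum_(j | (j != i) && ~~ (d i j <= LB)) x i j.
have m_far : m * far <= alpha%:R * (z - LB).
  apply: (@le_trans _ _ (\sum_(j | j != i) (Num.max LB (d i j) - LB) * x i j)).
    rewrite [leRHS](bigID (fun j => d i j <= LB)) /= /far mulr_sumr.
    rewrite -[leLHS]add0r; apply: lerD.
      apply: sumr_ge0 => j /andP[ji _]; rewrite mulr_ge0 //.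
        by rewrite subr_ge0 le_max lexx.
      by rewrite x_ge0 // eq_sym.
    apply: ler_sum => j /andP[ji]; rewrite -ltNge => dj.
    apply: ler_wpM2r; first by rewrite x_ge0 // eq_sym.
    by apply: le_trans (gap i j dj) _; rewrite lerD2r le_max lexx orbT.
  under eq_bigr do rewrite mulrBl.
  by rewrite sumrB -mulr_sumr sum_x; have := cost i; lra.
have near_le : \sum_(j | (j != i) && (d i j <= LB)) x i j
    <= \sum_(j | (j != i) && (d i j <= LB)) y j.
  by apply: ler_sum => j /andP[ji _]; rewrite x_le // eq_sym.
have := sum_x i; rewrite (bigID (fun j => d i j <= LB)) /= -/far => <-.
rewrite ler_pdivlMr // mulrC; apply: le_trans m_far.
by rewrite ler_pM2l //; lra.
Qed.

(** Solutions of (APCLB') with value close to [LB] violate the covering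
    constraints by little, uniformly in [i] since only finitely many distances
    exceed [LB]; compactness of the cube then removes the violation. *)
Lemma APCLB'_opt_AFSC_feasible (R : realType) (N : finType) (d : N -> N -> R)
    (alpha p : nat) (LB : R) :
  (0 < alpha)%N -> APCLB'_opt d alpha p LB = LB%:E ->
  exists2 y : N -> R, AFSC_feasible d alpha LB y & \sum_j y j <= p%:R.
Proof.
move=> alpha_gt0 optE.
have a_gt0 : 0 < (alpha%:R : R) by rewrite ltr0n.
have [m m_gt0 gap] := finite_gap (fun ij : N * N => d ij.1 ij.2) LB.
(* The budget constraint is indexed by [None], the covering ones by [Some i]. *)
pose g (k : option N) (y : N -> R) : R :=
  if k is Some i then
    alpha%:R * (1 - y i) - \sum_(j | (j != i) && (d i j <= LB)) y j
  else \sum_j y j - p%:R.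
(* Continuity in [y] only uses that of the coordinates [c j]. *)
have cg (T : topologicalType) (c : N -> T -> R) :
    (forall j, continuous (c j)) -> forall k, continuous (fun t => g k (c^~ t)).
  move=> cc; have csum P := @continuous_finite_sum R T N P c cc.
  case=> [i|] t; last by apply: cvgB; [exact: csum|exact: cvg_cst].
  apply: cvgB; last exact: csum.
  by apply: cvgM; [exact: cvg_cst|apply: cvgB; [exact: cvg_cst|exact: cc]].
pose T : topologicalType := prod_topology (fun _ : N => R).
have {}cg : forall k, continuous (g k : T -> R).
  exact: cg T (fun j y => y j) (@proj_continuous N (fun=> R)).
have cK : compact [set y : T | forall i, `[0, 1]%classic (y i)].
  exact: (@tychonoff N (fun=> R) (fun=> `[0, 1]%classic)
    (fun=> @segment_compact R 0 1)).
have [|y Ky gy] := compact_approx_feasible cK cg.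
  move=> e e_gt0.
  (* A value below [LB + e * m / alpha] makes the deficit bound at most [e]. *)
  have [_ [z [y [x feas]] <-]] : exists2 z, [set z%:E | z in
      [set z : R | exists y x, APCLB'_feasible d alpha p LB y x z]] z
      & (z < (LB + e * m / alpha%:R)%:E)%E.
    apply: ereal_inf_lt.
    rewrite -/(APCLB'_opt d alpha p LB) optE lte_fin ltrDl.
    by rewrite divr_gt0 // mulr_gt0.
  rewrite lte_fin -ltrBlDl => z_lt.
  exists y => [j /=|[i|] /=].
  - by case: feas => _ [_ [_ [_ [_ [_ [y01 _]]]]]]; rewrite in_itv /=.
  - apply: le_trans (APCLB'_deficit m_gt0 (fun i j => gap (i, j)) feas i) _.
    by rewrite ler_pdivrMr // mulrC -ler_pdivlMr // ltW.
  - by case: feas => -> _; rewrite subrr ltW.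
exists y; last by have := gy None; rewrite /= subr_le0.
split=> [i|j]; first by have := gy (Some i); rewrite /= subr_le0.
by have := Ky j; rewrite /= in_itv.
Qed.

Theorem theorem14 (R : realType) (N : finType) (d : N -> N -> R)
    (alpha p : nat) (LB : R)
    (d_ge0 : forall i j, 0 <= d i j)
    (p_gt0 : (0 < p)%N) (p_lt : (p < #|N|)%N)
    (alpha_gt0 : (0 < alpha)%N) (alpha_le : (alpha <= p)%N)
    (LB_bound : (LB%:E <= pCP_opt d alpha p)%E) :
  APCLB'_opt d alpha p LB = LB%:E <->
  exists y : N -> R, AFSC_feasible d alpha LB y /\ \sum_(j : N) y j <= p%:R.
Proof.
split=> [/(APCLB'_opt_AFSC_feasible alpha_gt0)[y feas sum_y]|[y [feas sum_y]]].
  by exists y.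
have pN : (p%:R : R) < #|N|%:R by rewrite ltr_nat.
have LB_ge0 := AFSC_feasible_delta_ge0 d_ge0 alpha_gt0 feas (le_lt_trans sum_y pN).
have [y' feas' sum_y'] := AFSC_feasible_sum_eq feas sum_y pN.
have [x xfeas] := AFSC_feasible_APCLB' LB_ge0 feas' sum_y'.
apply/eqP; rewrite eq_le; apply/andP; split.
  by apply: ereal_inf_lbound; exists LB => //; exists y', x.
apply: le_ereal_inf_tmp => _ [z [? [? [_ [_ [_ [_ [_ [_ [_ z_ge]]]]]]]]] <-].
by rewrite lee_fin.
Qed.
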